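(* Let $0\le s<\frac12$ and $T>0$. Suppose $v_0\in H^s(\mathbb{T})\mapsto v=:S_T(v_0)\in C([-T,T];H^s(\mathbb{T}))$ is the solution map for the equation $$i\partial_tv+\partial_x^2v=-iv^2\partial_x\overline v-\tfrac12|v|^4v+\mu[v]|v|^2v-\psi[v]v\quad\text{on }\mathbb{T}.$$ Then $S_T$ is not uniformly continuous on bounded subsets of $H^s(\mathbb{T})$; that is, there is a bounded set $B\subset H^s(\mathbb{T})$ such that $S_T|_B:B\to C([-T,T];H^s(\mathbb{T}))$ is not uniformly continuous (both sides with the $H^s$-based norm metrics).
   Context: $\mathbb{T}=\mathbb{R}/2\pi\mathbb{Z}$, $H^s(\mathbb{T})$ is the usual Sobolev space, and $$\mu[v]=\frac1{2\pi}\|v\|_{L^2(\mathbb{T})}^2,\qquad \psi[v]=\frac1{2\pi}\int_{\mathbb{T}}\Big(2\,\mathrm{Im}(v\partial_x\overline v)-\tfrac12|v|^4\Big)dx+\mu[v]^2 ,$$ evaluated at each time $t$. ''Solution map'' means that $S_T(v_0)$ is the solution of the equation with $v(0)=v_0$; in particular, if $v$ is a smooth solution of the equation on $[-T,T]\times\mathbb{T}$ then $S_T(v(0))=v$. *)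

(* Defs.v *)
From HB Require Import structures.
From mathcomp Require Import all_boot all_order all_algebra complex.
From mathcomp Require Import all_classical all_reals all_analysis.

Set Implicit Arguments.
Unset Strict Implicit.
Unset Printing Implicit Defensive.

Import Order.TTheory GRing.Theory Num.Theory.
Import numFieldNormedType.Exports.
Import ComplexField.Normc.

Local Open Scope classical_set_scope.
Local Open Scope ring_scope.
Local Open Scope complex_scope.

(* Functions on T = R/2piZ are 2pi-periodic functions R -> R[i]; integrals over
   T are integrals over [0, 2pi].  Elements of L^2(T) and H^s(T) are represented
   by such functions, two representatives being identified when they agree
   almost everywhere ([eqT]). *)

Section Torus.
Context {R : realType}.
Implicit Types (f g : R -> R[i]) (s T : R) (u w : R -> R -> R[i]).

Definition periodic2pi f : Prop := forall x, f (x + 2 * pi) = f x.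

Definition intT (h : R -> R) : R :=
  \int[lebesgue_measure]_(x in `[0, 2 * pi]) h x.

Definition cintT f : R[i] :=
  (intT (fun x => complex.Re (f x))) +i* (intT (fun x => complex.Im (f x))).

Definition eqT f g : Prop := ae_eq lebesgue_measure setT f g.

Definition L2T : set (R -> R[i]) := [set f |
  [/\ periodic2pi f,
      measurable_fun setT (fun x => complex.Re (f x)),
      measurable_fun setT (fun x => complex.Im (f x)) &
      (\int[lebesgue_measure]_(x in `[0%R, (2 * pi)%R]) (normc (f x) ^+ 2)%:E
         < +oo)%E] ].

Definition fourier_coef f (n : int) : R[i] :=
  ((2 * pi)^-1)%:C *
  cintT (fun x => f x * (cos (n%:~R * x) -i* sin (n%:~R * x))).

(* The square root of the sum over n in Z of (1 + n^2)^s |f^(n)|^2; it may be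
   +oo.  It is the H^s norm only on L2T: outside L2T the Fourier coefficients
   may be meaningless. *)
Definition Hs_norm s f : \bar R :=
  ((\esum_(n in [set: int])
      ((1 + (n%:~R : R) ^+ 2) `^ s * normc (fourier_coef f n) ^+ 2)%:E)
    `^ 2^-1)%E.

(* H^s(T), for s >= 0. *)
Definition Hs s : set (R -> R[i]) :=
  [set f | L2T f /\ (Hs_norm s f < +oo)%E].

(* C([-T, T]; H^s(T)); the values of u at times outside [-T, T] are
   irrelevant. *)
Definition CHs T s : set (R -> R -> R[i]) := [set u |
  (forall t : R, t \in `[- T, T] -> Hs s (u t)) /\
  (forall t0 : R, t0 \in `[- T, T] ->
     Hs_norm s (u t \- u t0) @[t --> within `[- T, T] (nbhs t0)] --> 0%E)].

Definition CHs_eq T u w : Prop :=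
  forall t : R, t \in `[- T, T] -> eqT (u t) (w t).

Definition CHs_dist T s u w : \bar R :=
  ereal_sup [set Hs_norm s (u t \- w t) | t in `[- T, T]].

End Torus.

Section Equation.
Context {R : realType}.
Implicit Types (f u : R -> R[i]) (v : R -> R -> R[i]).

Definition cderive f (x : R) : R[i] :=
  (derive1 (fun y => complex.Re (f y)) x) +i* (derive1 (fun y => complex.Im (f y)) x).

Definition mass u : R := (2 * pi)^-1 * intT (fun x => normc (u x) ^+ 2).

Definition psi u : R :=
  (2 * pi)^-1 *
    intT (fun x => 2 * complex.Im (u x * cderive (fun y => (u y)^*) x)
                   - 2^-1 * normc (u x) ^+ 4)
  + mass u ^+ 2.

(* Pointwise form of the equation at (t, x), where v t x is the value of the
   unknown at time t and position x. *)
Definition equation_at v (t x : R) : Prop :=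
  'i%C * cderive (fun t' => v t' x) t + cderive (cderive (v t)) x =
  - 'i%C * v t x ^+ 2 * cderive (fun y => (v t y)^*) x
  - (2^-1 * normc (v t x) ^+ 4)%:C * v t x
  + (mass (v t) * normc (v t x) ^+ 2)%:C * v t x
  - (psi (v t))%:C * v t x.

Fixpoint Ck2 (k : nat) (h : R -> R -> R) : Prop :=
  continuous (fun p : R * R => h p.1 p.2) /\
  match k with
  | 0 => True
  | k'.+1 =>
    [/\ forall t x, derivable (fun t' => h t' x) t 1 /\ derivable (h t) x 1,
        Ck2 k' (fun t x => derive1 (fun t' => h t' x) t) &
        Ck2 k' (fun t x => derive1 (h t) x)]
  end.

(* Smooth functions on [-T, T] x T are taken to be the restrictions of smooth
   functions on R x T, so that derivatives at t = -T, T are the one-sided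
   ones. *)
Definition smooth v : Prop :=
  (forall t, periodic2pi (v t)) /\
  (forall k, Ck2 k (fun t x => complex.Re (v t x)) /\
             Ck2 k (fun t x => complex.Im (v t x))).

Definition solves_on (T : R) v : Prop :=
  forall t : R, t \in `[- T, T] -> forall x : R, equation_at v t x.

(* For s < 1/2 the nonlinearity has no a priori meaning on C([-T, T]; H^s), so
   "S v0 is the solution with datum v0" is imposed for smooth functions: a
   smooth w is the path issued from w(0) exactly when it solves the equation.
   Nothing but the initial condition is required of non-smooth paths. *)
Record is_solution_map (s T : R) (S : (R -> R[i]) -> R -> R -> R[i]) : Prop :=
  IsSolutionMap {
    solmap_path : forall v0 : R -> R[i], Hs s v0 -> CHs T s (S v0) ;
    solmap_compat : forall v0 w0 : R -> R[i], Hs s v0 -> Hs s w0 -> eqT v0 w0 ->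
      CHs_eq T (S v0) (S w0) ;
    solmap_init : forall v0 : R -> R[i], Hs s v0 -> eqT (S v0 0) v0 ;
    solmap_smooth : forall w, smooth w ->
      (CHs_eq T (S (w 0)) w <-> solves_on T w)
  }.

End Equation.

Section Continuity.
Context {R : realType}.

Definition Hs_bounded (s : R) (B : set (R -> R[i])) : Prop :=
  exists M : R, forall f, B f -> (Hs_norm s f <= M%:E)%E.

Definition uniformly_continuous_on (s T : R)
    (S : (R -> R[i]) -> R -> R -> R[i]) (B : set (R -> R[i])) : Prop :=
  forall e : R, 0 < e -> exists2 d : R, 0 < d &
    forall f g, B f -> B g -> (Hs_norm s (f \- g)%R < d%:E)%E ->
      (CHs_dist T s (S f) (S g) < e%:E)%E.

End Continuity.

(* Main.v *)
Require Import Defs.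
From mathcomp Require Import all_boot all_order all_algebra complex.
From mathcomp Require Import all_classical all_reals all_analysis.
From mathcomp Require Import ring lra.
Import Order.TTheory GRing.Theory Num.Theory.
Import numFieldNormedType.Exports.
Import ComplexField.Normc measurable_realfun.
Local Open Scope classical_set_scope.
Local Open Scope ring_scope.

(** The equation has explicit plane wave solutions whose phase velocity depends
on their amplitude: for a >= 0 and an integer k,

      v(t, x) = a e^(i (k x - (k^2 + k a^2) t))

is a smooth solution ([plane_wave_smooth], [plane_wave_solves]), because on such
a wave the mass is a^2, psi is - 2 k a^2 + a^4 / 2, and the nonlinearity reduces
to k a^2 v.  A solution map must therefore send the datum a e^(i k x) to this
wave.

Two waves with the same frequency k = n > 0 and amplitudes a < b drift out of
phase at speed n (b^2 - a^2).  If n (b^2 - a^2) T = pi they are in phase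
opposition at time T, so that their H^s distance is then (1 + n^2)^(s/2) (a + b)
([solution_map_plane_wave_dist]).  Take a = (1 + n^2)^(-s/2), so that the first
datum has norm 1.  Then the distance at time T is at least 1, while

      (1 + n^2)^s (b^2 - a^2) = pi (1 + n^2)^s / (n T)

tends to 0 as n grows, exactly because 2 s < 1 ([powR_growth_lt_linear]).  Hence
the data stay in the ball of radius 2 and become arbitrarily close in H^s, while
the solutions remain at distance at least 1: uniform continuity fails on that
ball. *)

(** * The exponential of an imaginary number *)

Section Expi.
Context {R : realType}.
Implicit Types (A B : R[i]) (a b p q x y : R) (k : int).
Local Open Scope complex_scope.

Definition expi y : R[i] := cos y +i* sin y.

Lemma expi0 : expi 0 = 1.
Proof. by rewrite /expi cos0 sin0. Qed.

Lemma expiD x y : expi (x + y) = expi x * expi y.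
Proof. by rewrite /expi cosD sinD; simpc; congr (_ +i* _); ring. Qed.

Lemma expiN x : expi (- x) = (expi x)^*%C.
Proof. by rewrite /expi cosN sinN. Qed.

Lemma expi_conjM x : expi x * (expi x)^*%C = 1.
Proof. by rewrite -expiN -expiD subrr expi0. Qed.

Lemma expi_pi : expi pi = -1.
Proof.
by rewrite /expi cospi sinpi; apply/eqP; rewrite eq_complex /= oppr0 !eqxx.
Qed.

Lemma expi_2pi : expi (2 * pi) = 1.
Proof. by rewrite mulr_natl mulr2n expiD expi_pi mulrNN mulr1. Qed.

Lemma expi_int2pi k : expi (k%:~R * (2 * pi)) = 1.
Proof.
have nat_case n : expi (n%:R * (2 * pi)) = 1.
  elim: n => [|n IHn]; first by rewrite mul0r expi0.
  by rewrite -natr1 mulrDl mul1r expiD IHn mul1r expi_2pi.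
case: k => n; first exact: nat_case.
rewrite NegzE mulrNz mulNr expiN nat_case.
by apply/eqP; rewrite eq_complex /= oppr0 !eqxx.
Qed.

Lemma normc_expi x : normc (expi x) = 1.
Proof. by rewrite /= cos2Dsin2 sqrtr1. Qed.

Lemma normc_real a : 0 <= a -> normc a%:C = a.
Proof. by move=> a0; rewrite /= expr0n addr0 sqrtr_sqr ger0_norm. Qed.

Lemma Re_mulC A B : complex.Re (A * B) =
  complex.Re A * complex.Re B - complex.Im A * complex.Im B.
Proof. by case: A B => [? ?] [? ?]. Qed.

Lemma Im_mulC A B : complex.Im (A * B) =
  complex.Re A * complex.Im B + complex.Im A * complex.Re B.
Proof. by case: A B => [? ?] [? ?]. Qed.

(** The real and imaginary parts of A e^(i (p x + q)) are of this form, and the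
form is stable under differentiation in x; this is what makes inductions on the
order of differentiation possible. *)
Definition trig a b p q x := a * cos (p * x + q) + b * sin (p * x + q).

Lemma is_derive_trig a b p q x :
  is_derive x 1 (trig a b p q) (trig (p * b) (- (p * a)) p q x).
Proof.
have dphase : is_derive x 1 (fun y : R => p * y + q) p.
  apply: is_derive_eq.
  by rewrite addr0 [LHS]mulr1.
have dcos := @is_derive1_comp _ cos (fun y => p * y + q) x _ _
  (is_derive_cos (p * x + q)) dphase.
have dsin := @is_derive1_comp _ sin (fun y => p * y + q) x _ _
  (is_derive_sin (p * x + q)) dphase.
apply: (is_derive_eq (is_deriveD (is_deriveZ a dcos) (is_deriveZ b dsin))).
rewrite /trig /GRing.scale /=; ring.
Qed.

Lemma derive1_trig a b p q :
  derive1 (trig a b p q) = trig (p * b) (- (p * a)) p q.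
Proof.
apply/funext => x; rewrite derive1E.
exact: (@derive_val _ _ _ _ _ _ _ (is_derive_trig a b p q x)).
Qed.

Lemma derivable_trig a b p q x : derivable (trig a b p q) x 1.
Proof. by case: (is_derive_trig a b p q x). Qed.

Lemma continuous_trig a b p q : continuous (trig a b p q).
Proof.
move=> x; apply: differentiable_continuous; apply/derivable1_diffP.
exact: derivable_trig.
Qed.

(** The phase p x + q t treats space and time alike, so that derivatives in t
follow from those in x. *)
Lemma trig_swap a b p q t x : trig a b p (q * t) x = trig a b q (p * x) t.
Proof. by rewrite /trig (addrC (p * x)). Qed.

Lemma continuous2_trig a b p q :
  continuous (fun z : R * R => trig a b p (q * z.1) z.2).
Proof.
have cphase : continuous (fun z : R * R => p * z.2 + q * z.1).
  move=> z; apply: cvgD; apply: cvgM; try exact: cvg_cst.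
    exact: cvg_snd.
  exact: cvg_fst.
move=> z; apply: cvgD; (apply: cvgM; first exact: cvg_cst).
- exact: (continuous_comp (cphase z) (@continuous_cos R _)).
- exact: (continuous_comp (cphase z) (@continuous_sin R _)).
Qed.

Lemma Ck2_trig l a b p q : Ck2 l (fun t x => trig a b p (q * t) x).
Proof.
elim: l a b => [|l IHl] a b; split=> //; try exact: continuous2_trig.
split.
- move=> t x; split; last exact: derivable_trig.
  rewrite (_ : (fun t' => _) = trig a b q (p * x)); first exact: derivable_trig.
  by apply/funext => t'; rewrite trig_swap.
- rewrite (_ : (fun t x => _) =
      fun t x => trig (q * b) (- (q * a)) p (q * t) x).
    exact: IHl.
  apply/funext => t; apply/funext => x; rewrite trig_swap -derive1_trig.
  by congr (derive1 _ t); apply/funext => t'; rewrite trig_swap.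
- rewrite (_ : (fun t x => _) =
      fun t x => trig (p * b) (- (p * a)) p (q * t) x).
    exact: IHl.
  by apply/funext => t; apply/funext => x; rewrite derive1_trig.
Qed.

Lemma Re_expi A p q : (fun x => complex.Re (A * expi (p * x + q))) =
  trig (complex.Re A) (- complex.Im A) p q.
Proof. by apply/funext => x; rewrite Re_mulC /trig mulNr. Qed.

Lemma Im_expi A p q : (fun x => complex.Im (A * expi (p * x + q))) =
  trig (complex.Im A) (complex.Re A) p q.
Proof. by apply/funext => x; rewrite Im_mulC /trig addrC. Qed.

Lemma cderive_expi A p q :
  cderive (fun x => A * expi (p * x + q)) =
  fun x => p%:C * 'i%C * A * expi (p * x + q).
Proof.
apply/funext => x; rewrite /cderive Re_expi Im_expi !derive1_trig /trig.
by case: A => a b; simpc; congr (_ +i* _); rewrite /=; ring.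
Qed.

(** An antiderivative of the same frequency p exists as p is nonzero, and it
takes equal values at 0 and 2 pi. *)
Lemma integral_trig a b p q : p != 0 -> expi (p * (2 * pi)) = 1 ->
  intT (trig a b p q) = 0.
Proof.
move=> p0 [cp sp].
have pi20 : 0 < 2 * pi :> R by rewrite mulr_gt0 ?pi_gt0.
have dF x := derivable_trig (- (p^-1 * b)) (p^-1 * a) p q x.
have cF := @continuous_trig (- (p^-1 * b)) (p^-1 * a) p q.
have -> : trig a b p q = derive1 (trig (- (p^-1 * b)) (p^-1 * a) p q).
  rewrite derive1_trig; congr (trig _ _ p q); field; exact: p0.
rewrite /intT /Rintegral.
rewrite (@continuous_FTC2 _ _ (trig (- (p^-1 * b)) (p^-1 * a) p q)) //=.
- rewrite /trig mulr0 add0r !(cosD, sinD) cp sp; ring.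
- rewrite derive1_trig; apply: continuous_subspaceT.
  exact: continuous_trig.
- split=> [x _||]; first exact: dF.
  + exact/cvg_at_right_filter/cF.
  + exact/cvg_at_left_filter/cF.
Qed.

Lemma torus_length : lebesgue_measure `[0 : R, 2 * pi] = (2 * pi)%:E.
Proof.
by rewrite lebesgue_measure_itv /= lte_fin mulr_gt0 ?pi_gt0 // -EFinB subr0.
Qed.

Lemma intT_cst a : intT (fun=> a) = 2 * pi * a.
Proof.
by rewrite /intT Rintegral_cst // [fine _](congr1 fine torus_length) /= mulrC.
Qed.
End Expi.

(** * Fourier modes and their Sobolev norms *)

Section Modes.
Context {R : realType}.
Implicit Types (A B : R[i]) (a b s x y : R) (k m n : int) (f g : R -> R[i]).
Local Open Scope complex_scope.

Definition mode A k x : R[i] := A * expi (k%:~R * x).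

Lemma mode0 A : mode A 0 = fun=> A.
Proof. by apply/funext => x; rewrite /mode mul0r expi0 mulr1. Qed.

Lemma mode_sub A B k : mode A k \- mode B k = mode (A - B) k.
Proof. by apply/funext => x; rewrite /mode /= mulrBl. Qed.

Lemma modeE A k : mode A k = fun x => A * expi (k%:~R * x + 0).
Proof. by apply/funext => x; rewrite addr0. Qed.

Lemma Re_mode A k :
  (fun x => complex.Re (mode A k x)) =
  trig (complex.Re A) (- complex.Im A) k%:~R 0.
Proof. by rewrite modeE Re_expi. Qed.

Lemma Im_mode A k :
  (fun x => complex.Im (mode A k x)) =
  trig (complex.Im A) (complex.Re A) k%:~R 0.
Proof. by rewrite modeE Im_expi. Qed.

Lemma normc_mode A k x : normc (mode A k x) = normc A.
Proof. by rewrite normcM normc_expi mulr1. Qed.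

Lemma periodic_mode A k : periodic2pi (mode A k).
Proof. by move=> x; rewrite /mode mulrDr expiD expi_int2pi mulr1. Qed.

Lemma cintT_mode A k : cintT (mode A k) = if k == 0 then (2 * pi)%:C * A else 0.
Proof.
rewrite /cintT; case: eqVneq => [->|k0].
  by rewrite mode0 !intT_cst; case: A => a b; simpc.
rewrite Re_mode Im_mode !integral_trig ?intr_eq0 //; exact: expi_int2pi.
Qed.

Lemma fourier_coef_mode A k n :
  fourier_coef (mode A k) n = if n == k then A else 0.
Proof.
rewrite /fourier_coef (_ : (fun x => _) = mode A (k - n)); last first.
  apply/funext => x; rewrite /mode rmorphB mulrBl expiD expiN /expi /= mulrA.
  by [].
rewrite cintT_mode subr_eq0 eq_sym; case: ifP => _; last by rewrite mulr0.
have pi20 : 2 * pi != 0 :> R by rewrite mulf_neq0 ?gt_eqF ?pi_gt0.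
by rewrite mulrA -rmorphM /= mulVf // mul1r.
Qed.

Lemma powR_half_sqr a s : 0 <= a -> (a `^ (s / 2)) ^+ 2 = a `^ s.
Proof.
by move=> a0; rewrite -powR_mulrn ?powR_ge0 // -powRrM divfK.
Qed.

(** Only the k-th term of the sum over the frequencies survives. *)
Lemma Hs_norm_mode s A k :
  Hs_norm s (mode A k) = ((1 + k%:~R ^+ 2) `^ (s / 2) * normc A)%:E.
Proof.
rewrite /Hs_norm.
rewrite (_ : (\esum_(n in _) _ )%E = ((1 + k%:~R ^+ 2) `^ s * normc A ^+ 2)%:E).
  rewrite poweR_EFin -(@powR_half_sqr (1 + _) s) ?addr_ge0 ?sqr_ge0 // -exprMn.
  rewrite powR12_sqrt ?sqr_ge0 // sqrtr_sqr ger0_norm //.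
  by rewrite mulr_ge0 ?powR_ge0 //; case: A => ? ?; exact: sqrtr_ge0.
pose term (n : int) := ((1 + n%:~R ^+ 2) `^ s * normc A ^+ 2)%:E.
rewrite -[RHS](@esum_set1 _ _ k term); last first.
  by rewrite lee_fin mulr_ge0 ?powR_ge0 ?sqr_ge0.
rewrite [RHS]esum_mkcond; apply: eq_esum => n _.
rewrite fourier_coef_mode in_set1; case: eqP => // _.
by rewrite normc0 expr0n mulr0.
Qed.

(** The regularity that makes the Fourier coefficients depend only on the class
of a function modulo equality almost everywhere. *)
Definition Cmeasurable f : Prop :=
  measurable_fun setT (fun x => complex.Re (f x)) /\
  measurable_fun setT (fun x => complex.Im (f x)).

Lemma L2T_measurable f : L2T f -> Cmeasurable f.
Proof. by case. Qed.

Lemma Cmeasurable_sub f g : Cmeasurable f -> Cmeasurable g ->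
  Cmeasurable (f \- g).
Proof.
move=> [mRf mIf] [mRg mIg]; split.
  rewrite (_ : (fun x => _) = fun x => complex.Re (f x) - complex.Re (g x)).
    exact: measurable_funB.
  by apply/funext => x /=; case: (f x) (g x) => [? ?] [? ?].
rewrite (_ : (fun x => _) = fun x => complex.Im (f x) - complex.Im (g x)).
  exact: measurable_funB.
by apply/funext => x /=; case: (f x) (g x) => [? ?] [? ?].
Qed.

Lemma Cmeasurable_mul f g : Cmeasurable f -> Cmeasurable g ->
  Cmeasurable (fun x => f x * g x).
Proof.
move=> [mRf mIf] [mRg mIg]; split.
  under eq_fun do rewrite Re_mulC.
  by apply: measurable_funB; apply: measurable_funM.
under eq_fun do rewrite Im_mulC.
by apply: measurable_funD; apply: measurable_funM.
Qed.

Lemma Cmeasurable_mode A k : Cmeasurable (mode A k).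
Proof.
split; [rewrite Re_mode|rewrite Im_mode]; apply: continuous_measurable_fun;
  exact: continuous_trig.
Qed.

Lemma intT_ae (h1 h2 : R -> R) :
  measurable_fun setT h1 -> measurable_fun setT h2 ->
  ae_eq lebesgue_measure setT h1 h2 -> intT h1 = intT h2.
Proof.
move=> m1 m2 h12; rewrite /intT /Rintegral; congr fine.
apply: ae_eq_integral => //.
- by apply/measurable_EFinP; apply: measurable_funTS.
- by apply/measurable_EFinP; apply: measurable_funTS.
apply: (@ae_eq_subset _ _ _ _ _ setT) => //.
exact: (ae_eq_comp EFin).
Qed.

Lemma cintT_ae f g : Cmeasurable f -> Cmeasurable g -> eqT f g ->
  cintT f = cintT g.
Proof.
move=> [? ?] [? ?] fg; congr (_ +i* _); apply: intT_ae => //.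
  exact: (ae_eq_comp (@complex.Re R) fg).
exact: (ae_eq_comp (@complex.Im R) fg).
Qed.

(** A solution map is only known almost everywhere in x: this transfers the
computation of norms from the explicit waves to the values of the map. *)
Lemma Hs_norm_ae s f g : Cmeasurable f -> Cmeasurable g -> eqT f g ->
  Hs_norm s f = Hs_norm s g.
Proof.
move=> mf mg fg; rewrite /Hs_norm; congr (_ `^ _)%E; apply: eq_esum => n _.
rewrite /fourier_coef.
have mchar : Cmeasurable (fun x => cos (n%:~R * x) -i* sin (n%:~R * x)).
  rewrite (_ : (fun x => _) = mode 1 (- n)); first exact: Cmeasurable_mode.
  by apply/funext => x; rewrite /mode mul1r rmorphN mulNr expiN.
rewrite (cintT_ae _ _ (Cmeasurable_mul _ _ mf mchar)
  (Cmeasurable_mul _ _ mg mchar)) //.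
exact: ae_eq_mul2r.
Qed.

Lemma Hs_mode s A k : Hs s (mode A k).
Proof.
split; last by rewrite Hs_norm_mode ltry.
case: (Cmeasurable_mode A k) => mR mI; split=> //; first exact: periodic_mode.
under eq_integral do rewrite normc_mode.
by rewrite integral_cst // [X in (_ * X)%E]torus_length -EFinM ltry.
Qed.

(** * Plane wave solutions *)

(** The frequency in time is the one that the equation imposes: k^2 comes from
the dispersion and k a^2 from what is left of the nonlinear terms. *)
Definition plane_wave a k t : R -> R[i] :=
  mode (a%:C * expi (- (k%:~R ^+ 2 + k%:~R * a ^+ 2) * t)) k.

Lemma plane_waveE a k t x : plane_wave a k t x =
  a%:C * expi (k%:~R * x + - (k%:~R ^+ 2 + k%:~R * a ^+ 2) * t).
Proof. by rewrite /plane_wave /mode expiD; ring. Qed.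

Lemma plane_wave0 a k : plane_wave a k 0 = mode a%:C k.
Proof. by rewrite /plane_wave mulr0 expi0 mulr1. Qed.

Lemma plane_wave_smooth a k : smooth (plane_wave a k).
Proof.
split=> [t|l]; first exact: periodic_mode.
pose w := - (k%:~R ^+ 2 + k%:~R * a ^+ 2).
split.
  rewrite (_ : (fun t x => _) = fun t x => trig a 0 k%:~R (w * t) x).
    exact: Ck2_trig.
  apply/funext => t; under eq_fun do rewrite plane_waveE.
  by rewrite Re_expi /= oppr0.
rewrite (_ : (fun t x => _) = fun t x => trig 0 a k%:~R (w * t) x).
  exact: Ck2_trig.
apply/funext => t; under eq_fun do rewrite plane_waveE.
by rewrite Im_expi.
Qed.

Lemma cderive_mode A k : cderive (mode A k) = mode (k%:~R%:C * 'i%C * A) k.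
Proof. by rewrite modeE cderive_expi -modeE. Qed.

Lemma mode_conj A k : (fun x => (mode A k x)^*%C) = mode A^*%C (- k).
Proof.
by apply/funext => x; rewrite /mode rmorphM rmorphN mulNr expiN.
Qed.

Lemma mass_mode A k : mass (mode A k) = normc A ^+ 2.
Proof.
rewrite /mass; under eq_fun do rewrite normc_mode.
by rewrite intT_cst mulKf // mulf_neq0 ?gt_eqF ?pi_gt0.
Qed.

Lemma normc2E A : (normc A ^+ 2)%:C = A * A^*%C.
Proof.
case: A => a b; rewrite sqr_sqrtr ?addr_ge0 ?sqr_ge0 //; simpc.
by congr (_ +i* _); ring.
Qed.

Lemma psi_mode A k :
  psi (mode A k) = - 2 * k%:~R * normc A ^+ 2 + 2^-1 * normc A ^+ 4.
Proof.
rewrite /psi mass_mode [X in intT X](_ : _ =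
  fun=> - 2 * k%:~R * normc A ^+ 2 - 2^-1 * normc A ^+ 4).
  by rewrite intT_cst mulKf ?mulf_neq0 ?gt_eqF ?pi_gt0 //; field.
apply/funext => x; rewrite normc_mode mode_conj cderive_mode; congr (_ - _).
rewrite (_ : mode A k x * _ = - (k%:~R * normc A ^+ 2)%:C * 'i%C).
  by rewrite Im_mulC /=; ring.
have -> : (k%:~R * normc A ^+ 2)%:C = k%:~R%:C * (A * A^*%C).
  by rewrite -normc2E rmorphM.
rewrite /mode !rmorphN !mulNr expiN.
have := expi_conjM (k%:~R * x); set E := expi _ => EE.
transitivity (- k%:~R%:C * 'i%C * A * A^*%C * (E * E^*%C)); first by ring.
by rewrite EE; ring.
Qed.

Lemma conj_realM a B : (a%:C * B)^*%C = a%:C * B^*%C.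
Proof. by case: B => b c; simpc. Qed.

(** Every term of the equation is a multiple of the wave itself.  The cubic
derivative term contributes - k a^2, and the remaining ones contribute
- a^4 / 2 + a^4 - psi = 2 k a^2, so that the time frequency w must satisfy
w + k^2 = - k a^2. *)
Lemma plane_wave_solves T a k : 0 <= a -> solves_on T (plane_wave a k).
Proof.
move=> a0 t _ x; rewrite /equation_at /plane_wave.
have [w wE] : exists w, w = - (k%:~R ^+ 2 + k%:~R * a ^+ 2) by eexists.
rewrite -wE.
have nA : normc (a%:C * expi (w * t)) = a.
  by rewrite normcM normc_expi mulr1 normc_real.
rewrite mass_mode psi_mode normc_mode nA mode_conj !cderive_mode.
under [fun t' => mode _ _ _]eq_fun => t'.
  rewrite (_ : mode _ _ _ = mode a%:C k x * expi (w * t' + 0)); last first.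
    by rewrite /mode addr0; ring.
  over.
rewrite cderive_expi addr0 conj_realM /mode !rmorphN !mulNr expiN.
have PP := expi_conjM (w * t); have EE := expi_conjM (k%:~R * x).
set P := expi (w * t) in PP *; set E := expi (k%:~R * x) in EE *.
(* The part of a^4 common to the quintic term, the mass term and psi cancels,
   whatever its value h. *)
set h := 2^-1 * a ^+ 4; set i := 'i%C.
have -> : a ^+ 2 * a ^+ 2 = h + h by rewrite /h; field.
move: h => h.
have ii : i * i = -1 by rewrite -expr2 sqr_i.
transitivity (i * i * (w + k%:~R ^+ 2)%:C * (a%:C * P * E)).
  rewrite !(rmorphM, rmorphD, rmorphXn) /=; ring.
transitivity (i * i * (k%:~R * a ^+ 2)%:C * (P * P^*%C) * (E * E^*%C)
    * (a%:C * P * E)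
  + (2 * (k%:~R * a ^+ 2))%:C * (a%:C * P * E)).
  rewrite PP EE ii wE !(rmorphM, rmorphD, rmorphN, rmorphXn) /=; ring.
rewrite !(rmorphM, rmorphD, rmorphN, rmorphXn) /=; ring.
Qed.
End Modes.

(** * Two waves in phase opposition *)

Section PhaseOpposition.
Context {R : realType}.
Implicit Types (a b c s T : R) (k : int).
Local Open Scope complex_scope.

(** The left-hand side grows like n^(2 s), and 2 s < 1. *)
Lemma powR_growth_lt_linear s c : 0 <= s -> s < 2^-1 -> 0 < c ->
  exists2 n : nat, (0 < n)%N & (1 + n%:R ^+ 2) `^ s < c * n%:R.
Proof.
move=> s0 s1 c0.
have e0 : 0 < 1 - 2 * s by lra.
pose K := 2 `^ s / c.
have K0 : 0 < K by rewrite divr_gt0 ?powR_gt0.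
pose n := Num.bound (K `^ (1 - 2 * s)^-1).
have Kn : K `^ (1 - 2 * s)^-1 < n%:R by apply: archi_boundP; exact: powR_ge0.
have n0 : 0 < n%:R :> R by apply: le_lt_trans Kn; exact: powR_ge0.
have n1 : 1 <= n%:R :> R by rewrite ler1n -(ltr0n R).
exists n; first by rewrite -(ltr0n R).
have Kne : K < n%:R `^ (1 - 2 * s).
  have := gt0_ltr_powR e0 _ _ Kn; rewrite -powRrM mulVf ?gt_eqF //.
  rewrite powRr1 ?ltW //.
  by apply; rewrite nnegrE ?powR_ge0 ?ler0n.
have -> : c * n%:R = c * n%:R `^ (1 - 2 * s) * n%:R `^ (2 * s).
  by rewrite -mulrA -powRD ?subrK ?powRr1 // oner_eq0.
have : (1 + n%:R ^+ 2) `^ s <= 2 `^ s * n%:R `^ (2 * s).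
  rewrite powRrM powR_mulrn // -powRM ?sqr_ge0 //.
  apply: ge0_ler_powR => //; rewrite ?nnegrE ?addr_ge0 ?mulr_ge0 ?sqr_ge0 //.
  by nra.
move=> /le_lt_trans; apply; rewrite ltr_pM2r ?powR_gt0 //.
by move: Kne; rewrite /K ltr_pdivrMr // mulrC.
Qed.

(** The phases at time T differ by pi, so that subtracting the waves adds the
amplitudes. *)
Lemma plane_wave_opposite a b k T : k%:~R * (b ^+ 2 - a ^+ 2) * T = pi ->
  plane_wave a k T \- plane_wave b k T =
  mode ((a + b)%:C * expi (- (k%:~R ^+ 2 + k%:~R * a ^+ 2) * T)) k.
Proof.
move=> abT; rewrite /plane_wave mode_sub; congr (mode _ k).
have -> : - (k%:~R ^+ 2 + k%:~R * b ^+ 2) * T =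
    - (k%:~R ^+ 2 + k%:~R * a ^+ 2) * T - pi by rewrite -abT; ring.
rewrite expiD expiN expi_pi rmorphN rmorph1 rmorphD /=; ring.
Qed.

Lemma solution_map_plane_wave_dist s T S a b k : is_solution_map s T S ->
  0 <= a -> 0 <= b -> 0 <= T -> k%:~R * (b ^+ 2 - a ^+ 2) * T = pi ->
  (((1 + k%:~R ^+ 2) `^ (s / 2) * (a + b))%:E <=
     CHs_dist T s (S (plane_wave a k 0)) (S (plane_wave b k 0)))%E.
Proof.
move=> hS a0 b0 T0 abT.
have T_in : T \in `[- T, T] by rewrite in_itv /= lexx andbT; lra.
have solution c : 0 <= c -> Cmeasurable (S (plane_wave c k 0) T) /\
    eqT (S (plane_wave c k 0) T) (plane_wave c k T).
  move=> c0; split; last first.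
    apply: (proj2 (solmap_smooth hS (plane_wave_smooth c k))) => //.
    exact: plane_wave_solves.
  have [+ _] := solmap_path hS (Hs_mode s _ k : Hs s (plane_wave c k 0)).
  by move=> /(_ _ T_in)[/L2T_measurable].
have [[mSa Sa] [mSb Sb]] := (solution a a0, solution b b0).
apply: ereal_sup_ubound; exists T => //.
rewrite (@Hs_norm_ae _ _ _ (plane_wave a k T \- plane_wave b k T)).
- by rewrite plane_wave_opposite // Hs_norm_mode normcM normc_expi mulr1
    normc_real ?addr_ge0.
- exact: Cmeasurable_sub.
- by apply: Cmeasurable_sub; exact: Cmeasurable_mode.
- exact: ae_eq_sub.
Qed.
End PhaseOpposition.

Theorem proposition1p2 (R : realType) (s T : R) (hs0 : 0 <= s) (hs1 : s < 2^-1)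
    (hT : 0 < T) (S : (R -> R[i]) -> R -> R -> R[i])
    (hS : is_solution_map s T S) :
  exists B : set (R -> R[i]),
    [/\ B `<=` Hs s, Hs_bounded s B & ~ uniformly_continuous_on s T S B].
Proof.
exists [set f | Hs s f /\ (Hs_norm s f <= 2%:E)%E]; split; first by move=> f [].
  by exists 2 => f [].
move=> /(_ 1 ltr01)[d d0 unif].
have pi0 : 0 < pi :> R := pi_gt0 R.
(* The bound 3 keeps the square of the norm of the second datum, which is
   1 + r, below 4; the bound d makes the two data closer than d. *)
pose m := Num.min 3 d.
have m0 : 0 < m by rewrite lt_min d0 andbT.
have [n n0 growth] := @powR_growth_lt_linear R s (m * T / pi) hs0 hs1
  (divr_gt0 (mulr_gt0 m0 hT) pi0).
have nR0 : 0 < n%:R :> R by rewrite ltr0n.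
pose k : int := n; pose M : R := (1 + k%:~R ^+ 2) `^ (s / 2).
have w0 : 0 < 1 + n%:R ^+ 2 :> R by rewrite ltr_pwDl ?sqr_ge0.
have M0 : 0 < M by rewrite powR_gt0.
pose a := M^-1; pose b := Num.sqrt (a ^+ 2 + pi / (n%:R * T)).
have a0 : 0 < a by rewrite invr_gt0.
have gap0 : 0 < pi / (n%:R * T) by rewrite divr_gt0 ?mulr_gt0.
have b0 : 0 <= b := sqrtr_ge0 _.
have bE : b ^+ 2 = a ^+ 2 + pi / (n%:R * T).
  by rewrite sqr_sqrtr // addr_ge0 ?sqr_ge0 ?ltW.
have Ma : M * a = 1 by rewrite divff ?gt_eqF.
have r0 : 0 < M ^+ 2 * (pi / (n%:R * T)) by rewrite mulr_gt0 ?exprn_gt0.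
have rm : M ^+ 2 * (pi / (n%:R * T)) < m.
  rewrite /M powR_half_sqr ?ltW //.
  rewrite mulrA ltr_pdivrMr ?mulr_gt0 // -ltr_pdivlMr //.
  by rewrite (_ : m * _ / pi = m * T / pi * n%:R) //; ring.
move: r0 rm; set r := M ^+ 2 * _ => r0 rm.
have [r3 rd] : r < 3 /\ r < d by move: rm; rewrite lt_min => /andP.
have Mb2 : (M * b) ^+ 2 = 1 + r.
  by rewrite exprMn bE mulrDr -exprMn Ma expr1n.
have Mb0 : 0 <= M * b by rewrite mulr_ge0 // ltW.
have normE c : 0 <= c -> Hs_norm s (plane_wave c k 0) = (M * c)%:E.
  by move=> c0; rewrite plane_wave0 Hs_norm_mode normc_real.
have abT : k%:~R * (b ^+ 2 - a ^+ 2) * T = pi.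
  by rewrite bE -[k%:~R]/(n%:R); field; rewrite !gt_eqF //.
suff : (CHs_dist T s (S (plane_wave a k 0)) (S (plane_wave b k 0)) < 1%:E)%E.
  apply/negP; rewrite -leNgt.
  have := solution_map_plane_wave_dist _ _ _ _ _ _ hS (ltW a0) b0 (ltW hT) abT.
  apply: le_trans.
  by rewrite lee_fin -/M mulrDr Ma; lra.
apply: unif.
- by split; [exact: Hs_mode|rewrite (normE a (ltW a0)) lee_fin Ma; lra].
- by split; [exact: Hs_mode|rewrite normE // lee_fin; nra].
- rewrite !plane_wave0 mode_sub Hs_norm_mode -rmorphB -normcN -rmorphN opprB.
  have ab : a <= b by rewrite -(ler_pM2l M0) Ma; nra.
  rewrite normc_real ?subr_ge0 // lte_fin -/M mulrBr Ma; nra.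
Qed.
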